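(* For any Polish group $G$, there is a universal Borel $G$-space $\mathcal{U}_G$. Moreover, $\mathcal{U}_G$ can be taken to be a Polish $G$-space.
   Context: A Polish space (group) is a separable, completely metrizable topological space (group). A standard Borel space is a Polish space with its associated Borel structure. For a Polish group $G$, a Borel $G$-space is a standard Borel space $X$ together with an action $G\times X\to X$, $(g,x)\mapsto g\cdot x$, of $G$ that is a Borel map; a Polish $G$-space is a Polish space together with an action of $G$ on it that is continuous as a map $G\times X\to X$ (so every Polish $G$-space is a Borel $G$-space). A Borel embedding of a Borel $G$-space $X$ into a Borel $G$-space $Y$ is a Borel injection $\pi:X\to Y$ such that $\pi(g\cdot x)=g\cdot\pi(x)$ for all $g\in G$, $x\in X$. A Borel $G$-space $\mathcal{U}$ is universal if for every Borel $G$-space $X$ there is a Borel embedding of $X$ into $\mathcal{U}$. *)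

(* Defs.v *)
From HB Require Import structures.
From mathcomp Require Import all_boot all_order all_algebra.
From mathcomp Require Import all_classical all_reals all_analysis.

Set Implicit Arguments.
Unset Strict Implicit.
Unset Printing Implicit Defensive.

Import Order.TTheory GRing.Theory Num.Theory.

Local Open Scope classical_set_scope.
Local Open Scope ring_scope.

HB.structure Definition PreTopologicalGroup :=
  { G of Topological G & Group G }.

HB.mixin Record PreTopologicalGroup_isTopologicalGroup G
    & PreTopologicalGroup G := {
  mulg_continuous : continuous (fun p : G * G => (p.1 * p.2)%g) ;
  invg_continuous : continuous (fun g : G => (g^-1)%g)
}.

#[short(type="topologicalGroupType")]
HB.structure Definition TopologicalGroup :=
  { G of PreTopologicalGroup G & PreTopologicalGroup_isTopologicalGroup G }.

Definition metric (R : realType) (T : Type) (d : T -> T -> R) : Prop :=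
  [/\ forall x y, 0 <= d x y,
      forall x y, d x y = 0 <-> x = y,
      forall x y, d x y = d y x &
      forall x y z, d x z <= d x y + d y z].

Definition induces_topology (R : realType) (T : topologicalType)
    (d : T -> T -> R) : Prop :=
  forall A : set T,
    open A <-> forall x, A x -> exists2 e : R, 0 < e & [set y | d x y < e] `<=` A.

Definition cauchy_seq (R : realType) (T : Type) (d : T -> T -> R)
    (u : nat -> T) : Prop :=
  forall e : R, 0 < e -> exists N : nat, forall m n : nat,
    (N <= m)%N -> (N <= n)%N -> d (u m) (u n) < e.

Definition completely_metrizable (R : realType) (T : topologicalType) : Prop :=
  exists d : T -> T -> R,
    [/\ metric d, induces_topology d &
        forall u : nat -> T, cauchy_seq d u -> exists x : T, u @ \oo --> x].

Definition separable (T : topologicalType) : Prop :=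
  exists2 S : set T, countable S & dense S.

(* [R] is only the field of values of the metrics.  The empty space is Polish:
   this is why Borel structures are handled below as the sigma-algebras
   [<<s open >>] rather than through [measurableType], which is pointed. *)
Definition polish (R : realType) (T : topologicalType) : Prop :=
  separable T /\ completely_metrizable R T.

Definition borel_set (T : topologicalType) : set (set T) := <<s @open T >>.

Definition borel_map (S T : topologicalType) (f : S -> T) : Prop :=
  forall B : set T, borel_set B -> borel_set (f @^-1` B).

Definition group_action (G : groupType) (X : Type) (a : G -> X -> X) : Prop :=
  (forall x, a 1%g x = x) /\ (forall g h x, a (g * h)%g x = a g (a h x)).

(* A standard Borel space is given by a Polish space [X], of which only the
   Borel sets matter; [G * X] carries the Borel sets of the product topology. *)
Definition borel_Gspace (R : realType) (G : topologicalGroupType)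
    (X : topologicalType) (a : G -> X -> X) : Prop :=
  [/\ polish R X, group_action a & borel_map (fun p : G * X => a p.1 p.2)].

Definition polish_Gspace (R : realType) (G : topologicalGroupType)
    (X : topologicalType) (a : G -> X -> X) : Prop :=
  [/\ polish R X, group_action a & continuous (fun p : G * X => a p.1 p.2)].

Definition borel_embedding (G : topologicalGroupType) (X Y : topologicalType)
    (a : G -> X -> X) (b : G -> Y -> Y) (f : X -> Y) : Prop :=
  [/\ borel_map f, injective f & forall g x, f (a g x) = b g (f x)].

Definition universal_borel_Gspace (R : realType) (G : topologicalGroupType)
    (U : topologicalType) (b : G -> U -> U) : Prop :=
  borel_Gspace R b /\
  forall (X : topologicalType) (a : G -> X -> X), borel_Gspace R a ->
    exists f : X -> U, borel_embedding a b f.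

(* Main.v *)
(* Let [N] be a Birkhoff-Kakutani norm on [G], so that [N (h^-1 * h')] is a
   left-invariant distance inducing the topology.  The functions [G -> [0, 1]]
   that are 1-Lipschitz for it form, under pointwise convergence and left
   translation, a compact metrizable [G]-space; its countable power is the
   universal space.  Given a Borel [G]-space [X] and a countable base [A n] of
   its Polish topology, [x] is sent to the sequence of the truncated distances
   to the sets of inverses of the points near which [{g | g x \in A n}] is
   nonmeager.  This is equivariant because right translations preserve category,
   Borel by the Montgomery-Novikov theorem, and injective because it determines
   the sets [{g | g x \in A n}] up to a meager set, so that points [x], [y] with
   the same image satisfy [g x = g y] for some [g] by the Baire category
   theorem. *)
From HB Require Import structures.
Require Import Defs.
From mathcomp Require Import all_boot all_order all_algebra.
From mathcomp Require Import all_classical all_reals all_analysis.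
From mathcomp Require Import lra.

Set Implicit Arguments.
Unset Strict Implicit.
Unset Printing Implicit Defensive.

Import Order.TTheory GRing.Theory Num.Theory.
Import numFieldNormedType.Exports.

Local Open Scope classical_set_scope.
Local Open Scope ring_scope.

(** * Baire category and Borel sets *)

Lemma exists_natSinv_lt (R : realType) (e : R) : 0 < e ->
  exists n : nat, n.+1%:R^-1 < e.
Proof.
move=> e0; exists (Num.truncn e^-1).
rewrite invf_plt ?posrE //; exact: truncnS_gt.
Qed.

Definition base_seq (T : topologicalType) (B : nat -> set T) : Prop :=
  (forall n, open (B n)) /\
  forall (U : set T) x, open U -> U x -> exists2 n, B n x & B n `<=` U.

(** Reindexes a countable family by the natural numbers. Numbers that code no index give [set0],
    which changes neither a union nor a base. *)
Definition unpickled (J : countType) (T : Type) (F : J -> set T) (n : nat) :=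
  if unpickle n is Some i then F i else set0.

Lemma bigcup_unpickled (J : countType) (T : Type) (F : J -> set T) :
  \bigcup_n unpickled F n = \bigcup_i F i.
Proof.
apply/seteqP; split=> [x [n _]|x [i _ Fix]]; rewrite /unpickled.
  by case: unpickle => // i Fix; exists i.
by exists (pickle i) => //; rewrite pickleK.
Qed.

(** * Metrics, Polish spaces and the Baire category theorem *)

Section Metric.
Context (R : realType) (T : topologicalType) (d : T -> T -> R).
Hypotheses (dm : metric d) (dt : induces_topology d).

Lemma metricxx x : d x x = 0.
Proof. by case: dm => _ /(_ x x) [_ ->]. Qed.

Lemma open_metric_ball x (e : R) : open [set y | d x y < e].
Proof.
case: dm => _ _ _ dtri; apply/dt => y /= xy.
exists (e - d x y); first by rewrite subr_gt0.
by move=> z /= yz; apply: le_lt_trans (dtri x y z) _; rewrite -ltrBrDl.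
Qed.

Lemma open_metric_ballP (U : set T) x : open U -> U x ->
  exists2 e : R, 0 < e & [set y | d x y < e] `<=` U.
Proof. by move=> /dt; apply. Qed.

Lemma cvg_metricP (u : nat -> T) x : u @ \oo --> x <->
  forall e : R, 0 < e -> exists N : nat, forall n, (N <= n)%N -> d x (u n) < e.
Proof.
split=> [ux e e0|ux A].
  have /ux : nbhs x [set y | d x y < e].
    by apply: open_nbhs_nbhs; split; [exact: open_metric_ball|rewrite /= metricxx].
  by move=> [N _ NP]; exists N => n Nn; exact: NP.
rewrite nbhsE /= => -[U [oU Ux] UA].
have [e e0 eU] := open_metric_ballP oU Ux.
have [N NP] := ux _ e0.
by exists N => // n /= Nn; apply/UA/eU/NP.
Qed.

Lemma cvg_le_metric (u : nat -> T) x y (e : R) (N : nat) : u @ \oo --> x ->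
  (forall n, (N <= n)%N -> d y (u n) <= e) -> d y x <= e.
Proof.
move=> /cvg_metricP ux yu; apply/ler_addgt0Pr => r r0.
have [M MP] := ux _ r0; case: dm => _ _ dC dtri.
have := MP _ (leq_maxr N M); have := yu _ (leq_maxl N M).
have := dtri y (u (maxn N M)) x; rewrite (dC (u _) x); lra.
Qed.

End Metric.

Lemma polish_base_seq (R : realType) (T : topologicalType) : polish R T ->
  exists B : nat -> set T, base_seq B.
Proof.
move=> [[S /countable_injP [f finj] Sd] [d [dm dt _]]].
case: (dm) => _ _ dC dtri.
(* The ball of radius [p.2.+1%:R^-1] about the point of [S] with code [p.1]. The union has at most
   one term, as [f] is injective on [S], and it is empty when no point has that code. *)
pose F (p : nat * nat) : set T :=
  \bigcup_(s in S `&` [set s | f s = p.1]) [set y | d s y < p.2.+1%:R^-1].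
exists (unpickled F); split.
  move=> n; rewrite /unpickled; case: unpickle => [p|]; last exact: open0.
  by apply: bigcup_open => s _; exact: open_metric_ball.
move=> U x oU Ux; have [e e0 eU] := open_metric_ballP dt oU Ux.
have [k ke] : exists k : nat, k.+1%:R^-1 < e / 2 :> R.
  by apply: exists_natSinv_lt; rewrite divr_gt0.
have [s [/= xs Ss]] : [set y | d x y < k.+1%:R^-1] `&` S !=set0.
  by apply: Sd; [exists x; rewrite /= (metricxx dm) invr_gt0|exact: open_metric_ball].
exists (pickle (f s, k)); rewrite /unpickled pickleK.
  by exists s => //=; rewrite dC.
move=> y [s' [/= Ss' fs'] /= s'y]; apply: eU => /=.
have ss' : s' = s by apply: finj; rewrite ?inE.
by subst s'; have := dtri x s y; move: xs s'y ke; set r := _^-1; lra.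
Qed.

Lemma base_seq_dense_seq (T : topologicalType) (B : nat -> set T) (t0 : T) :
  base_seq B ->
  exists q : nat -> T, forall U, open U -> U !=set0 -> exists n, U (q n).
Proof.
move=> [_ Bb].
have /choice [q qP] : forall n, exists x : T, B n !=set0 -> B n x.
  move=> n; have [[x Bx]|nB] := pselect (B n !=set0); first by exists x.
  by exists t0 => /nB.
exists q => U oU [x Ux]; have [n Bnx BnU] := Bb _ _ oU Ux.
by exists n; apply/BnU/qP; exists x.
Qed.

(** Closed balls are nested inside [O] so that the ball of index [n.+1] lies in [D n] and has radius
    below [n.+1%:R^-1]. The centres are Cauchy, and their limit lies in all the balls. *)
Lemma polish_baire (R : realType) (T : topologicalType) (D : nat -> set T) :
  polish R T -> (forall n, open (D n) /\ dense (D n)) ->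
  dense (\bigcap_n D n).
Proof.
move=> [_ [d [dm dt dc]]] Dod O [x0 Ox0] oO; case: (dm) => d0 _ dC dtri.
(* Positivity of the radius is a premise of the property rather than of the choice, so [step] is
   total and can be iterated directly. *)
have /choice [step stepP] : forall np : nat * (T * R), exists p : T * R,
    0 < np.2.2 -> [/\ 0 < p.2, p.2 < np.1.+1%:R^-1, p.2 <= np.2.2 &
      [set y | d p.1 y <= p.2] `<=`
        D np.1 `&` [set y | d np.2.1 y < np.2.2]].
  move=> [n [x e]] /=.
  have [e0|e0] := boolP (0 < e); last by exists (x, e).
  have oW : open (D n `&` [set y | d x y < e]).
    by apply: openI; [case: (Dod n)|exact: open_metric_ball].
  have [y [/= xy Dy]] : [set y | d x y < e] `&` D n !=set0.
    by apply: (Dod n).2; [exists x; rewrite /= (metricxx dm)|exact: open_metric_ball].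
  have [r r0 rW] := open_metric_ballP dt oW (conj Dy xy).
  have n0 : 0 < n.+1%:R^-1 :> R by rewrite invr_gt0.
  (* Halving [r] puts the closed ball inside the open one; halving [n.+1%:R^-1] makes the bound on
     the new radius strict. *)
  exists (y, Num.min (r / 2) (Num.min (n.+1%:R^-1 / 2) e)) => _; split => /=.
  - by rewrite !lt_min e0 !divr_gt0.
  - by rewrite !gt_min; apply/orP; right; apply/orP; left; move: n0; set r' := _^-1; lra.
  - by rewrite !ge_min lexx !orbT.
  - move=> z /=; rewrite !le_min => /andP[zr _]; apply: rW => /=; lra.
have [e0 e00 eO] := open_metric_ballP dt oO Ox0.
pose s := fix s n := if n is m.+1 then step (m, s m) else (x0, e0 / 2).
have s0 n : 0 < (s n).2.
  by elim: n => [|n IH] /=; [rewrite divr_gt0|case: (stepP (n, s n) IH)].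
have sP n := stepP (n, s n) (s0 n).
have sball n y : d (s n.+1).1 y <= (s n.+1).2 ->
    D n y /\ d (s n).1 y < (s n).2.
  by move=> yn; have [_ _ _] := sP n; apply; exact: yn.
have nest n k y : d (s (n + k)%N).1 y <= (s (n + k)%N).2 ->
    d (s n).1 y <= (s n).2.
  elim: k y => [|k IH] y; first by rewrite addn0.
  by rewrite addnS => /sball[_ /ltW /IH].
have close n m : (n <= m)%N -> d (s n).1 (s m).1 <= (s n).2.
  move=> /subnKC <-; apply: (nest n (m - n)%N).
  by rewrite (metricxx dm) ltW.
have [x sx] : exists x : T, (fun n : nat => (s n).1 : T) @ \oo --> x.
  apply: dc => e e_gt0; have [N Ne] : exists N : nat, N.+1%:R^-1 < e / 2 :> R.
    by apply: exists_natSinv_lt; rewrite divr_gt0.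
  exists N.+1 => m n /close mN /close nN.
  have sN : (s N.+1).2 < N.+1%:R^-1 by case: (sP N).
  have := dtri (s m).1 (s N.+1).1 (s n).1; rewrite (dC (s m).1 (s N.+1).1).
  by move: sN Ne mN nN; set r := _^-1; lra.
have xball n : d (s n).1 x <= (s n).2.
  by apply: (cvg_le_metric dm dt (N := n) sx) => m; exact: close.
exists x; split; last by move=> n _; case: (sball n x).
by apply: eO => /=; have := xball 0%N; rewrite /=; lra.
Qed.

(** * Meager sets and the Baire property *)

Definition baire_space (T : topologicalType) : Prop :=
  forall D : nat -> set T, (forall n, open (D n) /\ dense (D n)) ->
  dense (\bigcap_n D n).

Section Meager.
Context (T : topologicalType).
Implicit Types (A U V W : set T).

(** Dual to being covered by countably many closed nowhere dense sets; stated with dense open sets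
    so that [baire_space] applies to it directly. *)
Definition meager A : Prop := exists D : nat -> set T,
  (forall n, open (D n) /\ dense (D n)) /\ \bigcap_n D n `<=` ~` A.

Lemma sub_meager A A' : A `<=` A' -> meager A' -> meager A.
Proof.
move=> AA' [D [Dod DA]]; exists D; split=> // x /DA nA' /AA'; exact: nA'.
Qed.

Lemma denseT : dense [set: T].
Proof. by move=> O [x Ox] _; exists x. Qed.

Lemma meager0 : meager set0.
Proof.
exists (fun=> setT); split => [_|x _ []].
by split; [exact: openT|exact: denseT].
Qed.

Lemma meager_bigcup (J : countType) (A : J -> set T) :
  (forall i, meager (A i)) -> meager (\bigcup_i A i).
Proof.
move=> /choice [D DP].
exists (fun n => if unpickle n is Some p then D p.1 p.2 else setT); split.
  move=> n; case: unpickle => [[i m]|]; first exact: (DP i).1.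
  by split; [exact: openT|exact: denseT].
move=> x Dx [i _ Aix]; apply: ((DP i).2 x) Aix => m _.
by have := Dx (pickle (i, m)) I; rewrite pickleK.
Qed.

Lemma meagerU A A' : meager A -> meager A' -> meager (A `|` A').
Proof.
move=> mA mA'.
apply: (@sub_meager _ (\bigcup_(b : bool) (if b then A else A'))).
  by move=> x [Ax|Ax]; [exists true|exists false].
by apply: meager_bigcup => -[].
Qed.

Lemma meagerC_dense U : open U -> dense U -> meager (~` U).
Proof.
move=> oU dU; exists (fun=> U); split => // x /(_ 0%N I) Ux; exact.
Qed.

Lemma meager_open_notin A U : baire_space T -> meager A -> open U ->
  U !=set0 -> exists2 x, U x & ~ A x.
Proof.
move=> bT [D [Dod DA]] oU U0.
by have [x [Ux /DA]] := bT _ Dod _ U0 oU; exists x.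
Qed.

(** Otherwise [U] would be covered by the two meager sets [V \ A] and [A & U], against the Baire
    hypothesis. *)
Lemma nonmeager_open A V U : baire_space T -> meager (V `\` A) ->
  open U -> U !=set0 -> U `<=` V -> ~ meager (A `&` U).
Proof.
move=> bT mVA oU U0 UV mAU.
have [x Ux] := meager_open_notin bT (meagerU mVA mAU) oU U0; apply.
by have [Ax|nAx] := pselect (A x); [right|left; split => //; exact: UV].
Qed.

(** A form of the Banach category theorem. The open sets that miss [U] or in which [A] is meager
    have a dense union [D]. Outside [D] everything is meager; inside [D], the points of [A] in [U]
    lie in the countably many basic sets in which [A] is meager. *)
Lemma meager_local (B : nat -> set T) A U : base_seq B ->
  (forall V, open V -> V !=set0 -> V `<=` U ->
    exists W, [/\ open W, W !=set0, W `<=` V & meager (A `&` W)]) ->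
  open U -> meager (A `&` U).
Proof.
move=> [Bo Bb] AU oU.
pose C := [set W : set T | open W /\ (meager (A `&` W) \/ W `&` U = set0)].
pose D := \bigcup_(W in C) W.
have oD : open D by apply: bigcup_open => W [oW _].
have dD : dense D.
  move=> V V0 oV; have [VU|/set0P/negP/negPn/eqP VU] :=
    pselect ((V `&` U) !=set0).
    have [W [oW [x Wx] WV mW]] := AU _ (openI oV oU) VU (@subIsetr _ _ _).
    exists x; split; first by have [] := WV _ Wx.
    by exists W => //; split => //; left.
  have [x Vx] := V0; exists x; split=> //; exists V => //.
  by split=> //; right.
pose E n := [set x | (A `&` B n) x /\ meager (A `&` B n)].
apply: (@sub_meager _ (~` D `|` \bigcup_n E n)).
  move=> x [Ax Ux]; have [[W [oW [mW|WU]] Wx]|nDx] := pselect (D x).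
  - right; have [n Bnx BnW] := Bb _ _ oW Wx; exists n => //; split => //.
    by apply: sub_meager mW => y [Ay /BnW].
  - by have : (W `&` U) x by []; rewrite WU.
  - by left.
apply: meagerU; first exact: meagerC_dense.
apply: meager_bigcup => n; have [mA|nA] := pselect (meager (A `&` B n)).
  by apply: sub_meager mA => x [].
by apply: sub_meager meager0 => x [].
Qed.

(** A local version of the usual property of differing from an open set by a meager set. Taking
    complements just exchanges the two alternatives. *)
Definition baire_property A : Prop := forall U, open U -> U !=set0 ->
  exists V, [/\ open V, V !=set0, V `<=` U &
                meager (A `&` V) \/ meager (V `\` A)].

(** If [A] were comeager in no nonempty basic set inside [U], only the meager alternative would
    occur there, and [meager_local] would make [A] meager in [U]. *)
Lemma baire_property_nonmeager (B : nat -> set T) A U : base_seq B ->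
  baire_property A -> open U -> ~ meager (A `&` U) ->
  exists n, [/\ B n !=set0, B n `<=` U & meager (B n `\` A)].
Proof.
move=> bB bA oU; apply: contra_notP => nU.
apply: (meager_local bB) => // V oV V0 VU.
have [W [oW [x Wx] WV [mW|mW]]] := bA V oV V0.
  by exists W; split=> //; exists x.
exfalso; apply: nU; have [n Bnx BnW] := bB.2 _ _ oW Wx.
exists n; split; first by exists x.
  exact: subset_trans BnW (subset_trans WV VU).
by apply: sub_meager mW => y [/BnW].
Qed.

(** The sets with the property form a sigma-algebra containing the open sets. For a countable union,
    either some term is comeager in an open subset of [U], or every term is meager in [U] by
    [meager_local]. *)
Lemma borel_baire_property (B : nat -> set T) A : base_seq B ->
  borel_set A -> baire_property A.
Proof.
move=> bB; suff : <<s @open T >> `<=` baire_property by apply.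
apply: smallest_sub; last first.
  move=> V oV U oU U0; have [VU|nVU] := pselect ((U `&` V) !=set0).
    exists (U `&` V); split => //; first exact: openI.
    by right; apply: sub_meager meager0 => x [[]].
  exists U; split => //; left.
  by apply: sub_meager meager0 => x [Vx Ux]; apply: nVU; exists x.
split.
- move=> U oU U0; exists U; split => //; left.
  by rewrite set0I; exact: meager0.
- move=> {}A bA U oU U0; have [V [oV V0 VU mV]] := bA U oU U0.
  exists V; split => //; rewrite setTD.
  case: mV => mV; [right|left]; apply: sub_meager mV => x [].
    by move=> Vx /contrapT.
  by [].
- move=> {}A bA U oU U0.
  have [[V [oV V0 VU [n mV]]]|nV] := pselect (exists V, [/\ open V, V !=set0,
      V `<=` U & exists n, meager (V `\` A n)]).
    exists V; split => //; right; apply: sub_meager mV.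
    by move=> x [Vx nA]; split => // Ax; apply: nA; exists n.
  exists U; split => //; left; rewrite setI_bigcupl; apply: meager_bigcup => n.
  apply: (meager_local bB) => // V oV V0 VU.
  have [W [oW W0 WV [mW|mW]]] := bA n V oV V0; first by exists W.
  exfalso; apply: nV; exists W; split=> //; last by exists n.
  exact: subset_trans WV VU.
Qed.

End Meager.

Lemma meager_homeo (S T : topologicalType) (f : S -> T) (g : T -> S)
    (A : set T) : continuous f -> continuous g -> cancel f g -> cancel g f ->
  meager A -> meager (f @^-1` A).
Proof.
move=> /continuousP fc /continuousP gc fK gK [D [Dod DA]].
exists (fun n => f @^-1` D n); split; last by move=> x Dx; exact: DA.
move=> n; split; first by apply: fc; exact: (Dod n).1.
move=> O [x Ox] oO; have [y [/= Oy Dy]] : (g @^-1` O) `&` D n !=set0.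
  by apply: (Dod n).2; [exists (f x); rewrite /= fK|exact: gc].
by exists (g y); split => //=; rewrite gK.
Qed.

(** * Borel sets and Borel maps *)

Section Borel.
Context (T : topologicalType).

Lemma borel_open (A : set T) : open A -> borel_set A.
Proof. by move=> oA; exact: sub_sigma_algebra. Qed.

Lemma borel_setC (A : set T) : borel_set A -> borel_set (~` A).
Proof. by rewrite -setTD; exact: sigma_algebraCD. Qed.

Lemma borel_bigcup (J : countType) (A : J -> set T) :
  (forall i, borel_set (A i)) -> borel_set (\bigcup_i A i).
Proof.
move=> bA; rewrite -bigcup_unpickled; apply: sigma_algebra_bigcup => n.
by rewrite /unpickled; case: unpickle => // ; exact: sigma_algebra0.
Qed.

Lemma borel_setU (A A' : set T) :
  borel_set A -> borel_set A' -> borel_set (A `|` A').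
Proof.
move=> bA bA'; rewrite -bigcup2E; apply: sigma_algebra_bigcup.
by move=> [|[|i]] //; exact: sigma_algebra0.
Qed.

Lemma borel_setD (A A' : set T) :
  borel_set A -> borel_set A' -> borel_set (A `\` A').
Proof.
move=> bA bA'; rewrite -[_ `\` _]setCK; apply: borel_setC.
by rewrite setDE setCI setCK; apply: borel_setU => //; exact: borel_setC.
Qed.

Lemma borel_bigcap (J : countType) (A : J -> set T) :
  (forall i, borel_set (A i)) -> borel_set (\bigcap_i A i).
Proof.
move=> bA; rewrite -(setCK (\bigcap_i A i)); apply: borel_setC.
by rewrite setC_bigcap; apply: borel_bigcup => i; exact: borel_setC.
Qed.

Lemma borel_cst (P : Prop) : borel_set [set _ : T | P].
Proof.
by apply: borel_open; have [p|np] := pselect P;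
  [rewrite (_ : mkset _ = setT) ?predeqE //; exact: openT
  |rewrite (_ : mkset _ = set0) ?predeqE //; exact: open0].
Qed.

End Borel.

Lemma borel_map_generated (S T : topologicalType) (f : S -> T) :
  (forall U, open U -> borel_set (f @^-1` U)) -> borel_map f.
Proof.
move=> fo; suff : <<s @open T >> `<=` [set B | borel_set (f @^-1` B)] by [].
apply: smallest_sub => //; split => /=.
- by rewrite preimage_set0; exact: sigma_algebra0.
- by move=> A; rewrite setTD preimage_setC => /borel_setC.
- by move=> A bA; rewrite preimage_bigcup; exact: borel_bigcup.
Qed.

Lemma borel_map_base (S T : topologicalType) (B : nat -> set T) (f : S -> T) :
  base_seq B -> (forall n, borel_set (f @^-1` B n)) -> borel_map f.
Proof.
move=> [_ Bb] fB; apply: borel_map_generated => U oU.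
(* Intersecting with a set that is full or empty selects the indices with [B n] inside [U] and keeps
   the union indexed by all [n]. *)
rewrite (_ : f @^-1` U = \bigcup_n (f @^-1` B n `&` [set _ | B n `<=` U])).
  apply: borel_bigcup => n; have [BU|BU] := pselect (B n `<=` U).
    by rewrite (_ : [set _ | _] = setT) ?setIT // predeqE.
  rewrite (_ : [set _ | _] = set0) ?setI0; first exact: sigma_algebra0.
  by rewrite predeqE.
apply/seteqP; split => [x Ux|x [n _ [Bx BU]]]; last exact: BU.
by have [n Bn BU] := Bb _ _ oU Ux; exists n.
Qed.

Lemma continuous_borel_map (S T : topologicalType) (f : S -> T) :
  continuous f -> borel_map f.
Proof.
move=> /continuousP fc; apply: borel_map_generated => U /fc; exact: borel_open.
Qed.

(* Montgomery and Novikov: the class of Borel sets [B] for which this holds is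
   closed under complement because, by the Baire property of the sections, a
   section fails to be comeager exactly if it is meager in some basic open set. *)
Lemma borel_nonmeager_section (T X : topologicalType) (B : nat -> set T)
    (A : set (T * X)) (V : set T) : base_seq B -> baire_space T ->
  borel_set A -> open V ->
  borel_set [set x | ~ meager ([set t | A (t, x)] `&` V)].
Proof.
move=> bB bT bA; move: V.
have pair1 (x : X) : continuous (fun t : T => (t, x)).
  by move=> t; apply: cvg_pair => //; exact: cvg_cst.
have pair2 (t : T) : continuous (fun x : X => (t, x)).
  by move=> x; apply: cvg_pair => //; exact: cvg_cst.
have bsec (C : set (T * X)) x : borel_set C -> borel_set [set t | C (t, x)].
  exact: (continuous_borel_map (pair1 x)).
(* All open [V] are treated at once because the complement step passes from [V] to basic sets inside
   it; Borelness of [C] is carried along to give its sections the Baire property. *)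
pose H := [set C : set (T * X) | borel_set C /\ forall V, open V ->
  borel_set [set x | ~ meager ([set t | C (t, x)] `&` V)]].
suff : <<s @open (T * X)%type >> `<=` H by move=> /(_ _ bA) [].
apply: smallest_sub; last first.
  move=> C oC; split; first exact: borel_open.
  move=> V oV; have [[t0]|T0] := pselect (inhabited T); last first.
    rewrite (_ : mkset _ = set0); first exact: sigma_algebra0.
    apply/seteqP; split=> // x; case.
    by apply: sub_meager (@meager0 T) => t; case: T0.
  have [q qP] := base_seq_dense_seq t0 bB.
  (* An open section that meets [V] does so in a nonempty open set, which is nonmeager and contains
     some [q n]. *)
  rewrite (_ : mkset _ = \bigcup_n ([set _ : X | V (q n)] `&`
      (fun x => (q n, x)) @^-1` C)); last first.
    apply/seteqP; split => x /=; last first.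
      move=> [n _ [/= Vq Cq]]; rewrite -[X in X `&` V]setIid -setIA.
      apply: (@nonmeager_open _ _ ([set t | C (t, x)] `&` V)) => //.
      + by apply: sub_meager (@meager0 T) => t [[]].
      + by apply: openI => //; move/continuousP: (pair1 x); exact.
      + by exists (q n).
    move=> nm; have [[t [Ct Vt]]|n0] := pselect
        (([set t | C (t, x)] `&` V) !=set0).
      have [] := qP ([set t | C (t, x)] `&` V).
      - by apply: openI => //; move/continuousP: (pair1 x); exact.
      - by exists t.
      - by move=> n [Cn Vn]; exists n.
    exfalso; apply: nm; apply: sub_meager (@meager0 T) => t tCV.
    by apply: n0; exists t.
  apply: borel_bigcup => n; apply: borel_open.
  have [Vq|Vq] := pselect (V (q n)).
    rewrite (_ : mkset _ = setT) ?setTI; last by rewrite predeqE.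
    by move/continuousP: (pair2 (q n)); exact.
  rewrite (_ : mkset _ = set0) ?set0I; last by rewrite predeqE.
  exact: open0.
split.
- split; first exact: sigma_algebra0.
  move=> V oV; rewrite (_ : mkset _ = set0); first exact: sigma_algebra0.
  apply/seteqP; split => // x; apply.
  by apply: sub_meager (@meager0 T) => t [].
- move=> C [bC HC]; split; first by rewrite setTD; exact: borel_setC.
  move=> V oV; rewrite setTD.
  (* The double negation makes the last set literally the complement of one covered by [HC]. *)
  rewrite (_ : mkset _ = \bigcup_n ([set _ | B n !=set0 /\ B n `<=` V] `&`
      [set x | ~ ~ meager ([set t | C (t, x)] `&` B n)])).
    apply: borel_bigcup => n.
    have [BV|BV] := pselect (B n !=set0 /\ B n `<=` V).
      rewrite (_ : [set _ | _] = setT) ?setTI; last by rewrite predeqE.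
      by apply: borel_setC; apply: HC; exact: bB.1.
    rewrite (_ : [set _ | _] = set0) ?set0I; last by rewrite predeqE.
    exact: sigma_algebra0.
  apply/seteqP; split=> x /=.
    move=> /(baire_property_nonmeager bB); case=> //.
      apply: (borel_baire_property bB); apply: (bsec (~` C)).
      exact: borel_setC.
    move=> n [Bn BnV mB]; exists n => //; split => //=; apply.
    by apply: sub_meager mB => t [/= Ct Bt]; split => //; exact.
  move=> [n _ [[Bn BnV] /= /contrapT mB]] mV.
  apply: (@nonmeager_open _ [set t | ~ C (t, x)] (B n) (B n)) => //.
  - by apply: sub_meager mB => t [Bt /= /contrapT].
  - exact: bB.1.
  - by apply: sub_meager mV => t [? /BnV].
- move=> C HC; split; first by apply: borel_bigcup => n; exact: (HC n).1.
  move=> V oV; rewrite (_ : mkset _ =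
      \bigcup_n [set x | ~ meager ([set t | C n (t, x)] `&` V)]).
    by apply: borel_bigcup => n; exact: (HC n).2.
  apply/seteqP; split => x /=.
    apply: contra_notP => nC.
    apply: (@sub_meager _ _ (\bigcup_n ([set t | C n (t, x)] `&` V))).
      by move=> t [[n _ Ct] Vt]; exists n.
    apply: meager_bigcup => n; apply: contrapT => nm.
    by apply: nC; exists n.
  move=> [n _ nm]; apply: contra_not nm; apply: sub_meager.
  by move=> t [Ct Vt]; split => //; exists n.
Qed.

(** * Polish spaces given by coordinates *)

Lemma real_cvg_seqP (R : realType) (u : nat -> R) (l : R) : u @ \oo --> l <->
  forall e : R, 0 < e -> exists N : nat, forall n, (N <= n)%N -> `|l - u n| < e.
Proof.
split=> [/cvgrPdist_lt ul e e0|ul]; last apply/cvgrPdist_lt => e e0.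
  by have [N _ NP] := ul _ e0; exists N => n Nn; exact: NP.
by have [N NP] := ul _ e0; exists N => // n /= Nn; exact: NP.
Qed.

Lemma real_cauchy_cvg (R : realType) (u : nat -> R) :
  cauchy_seq (fun x y : R => `|x - y|) u -> exists l : R, u @ \oo --> l.
Proof.
move=> uc; suff : cvg (u @ \oo) by move=> ?; exists (lim (u @ \oo)).
apply/cauchy_cvgP/cauchyP => e e0; have [N NP] := uc _ e0.
by exists (u N), N => // n /= Nn; apply: NP.
Qed.

Lemma filter_lt (T : Type) (F : set_system T) (P : nat -> set T) (m : nat) :
  Filter F -> (forall k, (k < m)%N -> F (P k)) ->
  F [set x | forall k, (k < m)%N -> P k x].
Proof.
move=> FF; elim: m => [|m IH] FP; first by apply: filterE.
have Fm : F [set x | forall k, (k < m)%N -> P k x].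
  by apply: IH => k /ltnW; exact: FP.
apply: filterS (filterI Fm (FP m (leqnn _))) => x [Px Pmx] k.
by rewrite ltnS leq_eqVlt => /predU1P[->//|]; exact: Px.
Qed.

(* The metric open sets form a topology whether or not [d] is a metric, so the
   instance below needs no hypothesis on [d]. *)
Definition metrized (R : realType) (T : Type) (d : T -> T -> R) : Type := T.

Section Metrized.
Context (R : realType) (T : Type) (d : T -> T -> R).

Definition metrized_open (A : set (metrized d)) : Prop :=
  forall x, A x -> exists2 e : R, 0 < e & [set y | d x y < e] `<=` A.

Lemma metrized_openT : metrized_open setT.
Proof. by move=> x _; exists 1. Qed.

Lemma metrized_openI : setI_closed metrized_open.
Proof.
move=> A B oA oB x [/oA[e e0 eA] /oB[r r0 rB]].
exists (Num.min e r); first by rewrite lt_min e0.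
by move=> y /=; rewrite lt_min => /andP[/eA ? /rB ?].
Qed.

Lemma metrized_open_bigcup (I : Type) (f : I -> set (metrized d)) :
  (forall i, metrized_open (f i)) -> metrized_open (\bigcup_i f i).
Proof.
move=> fo x [i _ /fo[e e0 ef]]; exists e => // y /ef fy; by exists i.
Qed.

HB.instance Definition _ := gen_eqMixin (metrized d).
HB.instance Definition _ := gen_choiceMixin (metrized d).
HB.instance Definition _ := isOpenTopological.Build (metrized d)
  metrized_openT metrized_openI metrized_open_bigcup.

Lemma metrized_induces : induces_topology (T := metrized d) d.
Proof. by []. Qed.

End Metrized.

(** A product metric pulled back along [c]. For coordinates in the unit interval the weights make
    the tail uniformly small, so the distance is controlled by finitely many coordinates. *)
Definition coord_dist (R : realType) (T : Type) (c : T -> nat -> R)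
    (x y : T) : R :=
  sup (range (fun k => `|c x k - c y k| / k.+1%:R)).

Section Coordinates.
Context (R : realType) (U : topologicalType) (c : U -> nat -> R).

Local Notation coord_dist := (coord_dist c).

Hypothesis ct : induces_topology coord_dist.

Hypothesis c01 : forall x k, 0 <= c x k <= 1.

Let c_le1 x y k : `|c x k - c y k| <= 1.
Proof.
have := c01 x k; have := c01 y k => /andP[? ?] /andP[? ?].
by rewrite ler_norml; apply/andP; split; lra.
Qed.

Let cS_le x y k : `|c x k - c y k| / k.+1%:R <= `|c x k - c y k|.
Proof. by rewrite ler_pdivrMr ?ltr0Sn // ler_peMr // ler1n. Qed.

Lemma coord_dist_ge x y k : `|c x k - c y k| <= k.+1%:R * coord_dist x y.
Proof.
rewrite mulrC -ler_pdivrMr ?ltr0Sn //; apply: ub_le_sup; last by exists k.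
by exists 1 => _ [j _ <-]; exact: le_trans (cS_le _ _ _) (c_le1 _ _ _).
Qed.

Lemma coord_dist_le x y e :
  (forall k, `|c x k - c y k| <= k.+1%:R * e) -> coord_dist x y <= e.
Proof.
move=> xye; apply: ge_sup; first by exists (`|c x 0%N - c y 0%N| / 1%:R), 0%N.
by move=> _ [k _ <-]; rewrite ler_pdivrMr ?ltr0Sn // mulrC.
Qed.

(** Coordinates of index [k >= m] contribute at most [k.+1%:R^-1], whatever the points. *)
Lemma coord_dist_le_inv x y m :
  (forall k, (k < m)%N -> `|c x k - c y k| <= m.+1%:R^-1) ->
  coord_dist x y <= m.+1%:R^-1.
Proof.
move=> xym; apply: coord_dist_le => k; have [km|mk] := ltnP k m.
  apply: le_trans (xym k km) _.
  by rewrite ler_peMl ?invr_ge0 // ler1n.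
apply: le_trans (c_le1 _ _ _) _.
by rewrite ler_pdivlMr ?ltr0Sn // mul1r ler_nat ltnS.
Qed.

Hypothesis c_inj : forall x y, (forall k, c x k = c y k) -> x = y.

Lemma coord_dist_metric : metric coord_dist.
Proof.
have D0 x y : 0 <= coord_dist x y.
  have := le_trans (normr_ge0 _) (coord_dist_ge x y 0%N).
  by rewrite mul1r.
split=> //.
- move=> x y; split=> [xy|->].
    apply: c_inj => k; have := coord_dist_ge x y k.
    by rewrite xy mulr0 normr_le0 subr_eq0 => /eqP.
  apply/eqP; rewrite eq_le D0 andbT.
  by apply: coord_dist_le => k; rewrite subrr normr0 mulr0.
- move=> x y; rewrite /coord_dist.
  by under eq_fun do rewrite distrC.
- move=> x y z; apply: coord_dist_le => k; rewrite mulrDr.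
  apply: le_trans (lerD (coord_dist_ge x y k) (coord_dist_ge y z k)).
  by rewrite (le_trans _ (ler_normD _ _)) // addrA subrK.
Qed.

Let ballP (x : U) (e : R) : 0 < e -> nbhs x [set y | coord_dist x y < e].
Proof.
move=> e0; apply: open_nbhs_nbhs; split => /=.
  exact: (open_metric_ball coord_dist_metric ct).
by rewrite (metricxx coord_dist_metric).
Qed.

Lemma continuous_coord k : continuous (fun x : U => c x k).
Proof.
move=> x; apply/cvgrPdist_lt => e e0.
have : nbhs x [set y | coord_dist x y < e / k.+1%:R].
  by apply: ballP; rewrite divr_gt0.
apply: filterS => y /= xy; apply: le_lt_trans (coord_dist_ge x y k) _.
by rewrite mulrC -ltr_pdivlMr.
Qed.

Lemma continuous_coords (S : topologicalType) (f : S -> U) :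
  (forall k, continuous (fun s => c (f s) k)) -> continuous f.
Proof.
move=> fc s A; rewrite nbhsE /= => -[V [oV Vf] VA].
have [e e0 eO] := open_metric_ballP ct oV Vf.
have [m me] := exists_natSinv_lt e0.
have : nbhs s [set t | forall k, (k < m)%N ->
    `|c (f s) k - c (f t) k| < m.+1%:R^-1].
  apply: filter_lt => k _; move/cvgrPdist_lt: (fc k s); apply.
  by rewrite invr_gt0.
apply: filterS => t st; apply/VA/eO => /=; apply: le_lt_trans me.
by apply: coord_dist_le_inv => k /st /ltW.
Qed.

(** The radius is half of [p.1.+1%:R^-1] so that two points of one cylinder satisfy the hypothesis
    of [coord_dist_le_inv]; rational centres keep the family countable. *)
Definition coord_cylinder (p : nat * seq rat) : set U :=
  [set x | forall k, (k < p.1)%N ->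
    `|ratr p.2`_k - c x k| < (p.1.+1%:R^-1) / 2].

Lemma coord_cylinder_base : base_seq (unpickled coord_cylinder).
Proof.
split=> [n|O x oO Ox].
  rewrite /unpickled; case: unpickle => [[m s]|]; last exact: open0.
  rewrite openE => x xW; apply: filter_lt => k km.
  have : nbhs x [set y | `|c x k - c y k| <
      m.+1%:R^-1 / 2 - `|ratr s`_k - c x k|].
    move/cvgrPdist_lt: (@continuous_coord k x); apply.
    by rewrite subr_gt0; exact: xW.
  apply: filterS => y /= xy; have -> : ratr s`_k - c y k =
    (ratr s`_k - c x k) + (c x k - c y k) by rewrite addrA subrK.
  by apply: le_lt_trans (ler_normD _ _) _; rewrite addrC -ltrBrDr.
have [e e0 eO] := open_metric_ballP ct oO Ox.
have [m me] := exists_natSinv_lt e0.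
have m0 : 0 < m.+1%:R^-1 / 2 :> R by rewrite divr_gt0 ?invr_gt0.
have /choice [s sP] : forall k, exists r : rat,
    `|ratr r - c x k| < m.+1%:R^-1 / 2.
  move=> k; have /rat_in_itvoo [r rP] : c x k - m.+1%:R^-1 / 2 < c x k + m.+1%:R^-1 / 2.
    by rewrite ltrD2l gtrN.
  by exists r; rewrite ltr_distl; rewrite in_itv in rP.
exists (pickle (m, mkseq s m)); rewrite /unpickled pickleK.
  by move=> k /= km; rewrite nth_mkseq.
move=> y yW; apply: eO => /=; apply: le_lt_trans me.
apply: coord_dist_le_inv => k km; have := yW k km; have := sP k.
rewrite /= nth_mkseq // => xs ys.
have -> : c x k - c y k = (ratr (s k) - c y k) - (ratr (s k) - c x k) by lra.
by apply: le_trans (ler_normB _ _) _; rewrite [leRHS]splitr ltW // ltrD.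
Qed.

(** The premise says that the image of [c] is closed under coordinatewise limits of sequences, which
    turns coordinatewise completeness of the reals into completeness of [coord_dist]. *)
Lemma coord_polish (x0 : U) :
  (forall u : nat -> U,
    (forall k, exists l : R, (fun i => c (u i) k) @ \oo --> l) ->
    exists x, forall k, (fun i => c (u i) k) @ \oo --> c x k) ->
  polish R U.
Proof.
move=> cc; split.
  have [q qP] := base_seq_dense_seq x0 coord_cylinder_base.
  exists (range q); first exact: card_image_le.
  by move=> O O0 oO; have [n Oq] := qP _ oO O0; exists (q n); split => //; exists n.
exists coord_dist; split => //; first exact: coord_dist_metric.
move=> u uc; have [|x ux] := cc u.
  move=> k; apply: real_cauchy_cvg => e e0.
  have [|N NP] := uc (e / k.+1%:R); first by rewrite divr_gt0.
  exists N => m n Nm Nn; apply: le_lt_trans (coord_dist_ge _ _ k) _.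
  by rewrite mulrC -ltr_pdivlMr // NP.
exists x; apply/(cvg_metricP coord_dist_metric ct) => e e0.
have [|N NP] := uc (e / 2); first by rewrite divr_gt0.
exists N => n Nn; apply: (@le_lt_trans _ _ (e / 2)); last by rewrite gtr_pMr // invf_lt1 // ltr1n.
(* The Cauchy bound beyond [N] is uniform in [k], so the later index [j] used for comparison with
   the limit may depend on [k]. *)
apply: coord_dist_le => k; apply/ler_addgt0Pr => r r0.
have /real_cvg_seqP /(_ _ r0) [M MP] := ux k.
have := MP _ (leq_maxr N M); set j := maxn N M => xj.
have nj := coord_dist_ge (u n) (u j) k.
have : k.+1%:R * coord_dist (u n) (u j) <= k.+1%:R * (e / 2).
  by rewrite ler_pM2l // ltW // NP // leq_maxl.
have := ler_normD (c x k - c (u j) k) (c (u j) k - c (u n) k).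
rewrite addrA subrK (distrC (c (u j) k)); move: nj xj.
set a := _ * coord_dist _ _; set b := _ * (e / 2); lra.
Qed.

Lemma borel_map_coords (S : topologicalType) (f : S -> U) :
  (forall k (r : R), borel_set [set s | c (f s) k < r]) -> borel_map f.
Proof.
move=> fb; apply: (borel_map_base coord_cylinder_base) => n.
rewrite /unpickled; case: unpickle => [[m s]|]; last first.
  by rewrite preimage_set0; exact: sigma_algebra0.
rewrite (_ : _ @^-1` _ = \bigcap_(k : 'I_m)
    [set t | `|ratr s`_k - c (f t) k| < m.+1%:R^-1 / 2]); last first.
  apply/seteqP; split => t /= tW; first by move=> k _; exact: tW.
  by move=> k km; exact: (tW (Ordinal km) I).
apply: borel_bigcap => -[k km] /=; set a := ratr _; set b := _ / 2.
(* An open interval written with strict upper bounds only: the countable intersection expresses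
   [c (f t) k <= a - b]. *)
rewrite (_ : mkset _ = ~` (~` [set t | c (f t) k < a + b] `|`
    \bigcap_j [set t | c (f t) k < a - b + j.+1%:R^-1])).
  apply: borel_setC; apply: borel_setU; first exact: borel_setC.
  by apply: borel_bigcap.
apply/seteqP; split => t /=.
  rewrite ltr_norml => /andP[h1 h2] []; first by apply; lra.
  have [j jP] : exists j : nat, j.+1%:R^-1 < c (f t) k - (a - b).
    by apply: exists_natSinv_lt; lra.
  by move=> /(_ j I) /=; rewrite -ltrBlDl => /(lt_trans jP); rewrite ltxx.
move=> /not_orP [/contrapT h1 h2]; rewrite ltr_norml; apply/andP; split.
  by lra.
suff : a - b < c (f t) k by lra.
rewrite ltNge; apply/negP => h3; apply: h2 => j _ /=.
by rewrite (le_lt_trans h3) // ltrDl invr_gt0.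
Qed.

End Coordinates.

(** * The Birkhoff-Kakutani theorem *)

Section Group.
Context (S : topologicalType) (G : topologicalGroupType).

Lemma continuous_mulg (a b : S -> G) : continuous a -> continuous b ->
  continuous (fun s => (a s * b s)%g).
Proof.
move=> ac bc s; apply: (@continuous_comp _ _ _ (fun s => (a s, b s))
  (fun p : G * G => (p.1 * p.2)%g)); last exact: mulg_continuous.
by apply: cvg_pair; [exact: ac|exact: bc].
Qed.

Lemma continuous_invg (a : S -> G) : continuous a ->
  continuous (fun s => (a s)^-1%g).
Proof.
by move=> ac s; apply: continuous_comp; [exact: ac|exact: invg_continuous].
Qed.

End Group.

(** Symmetry is not imposed: [N (h^-1 * h')] and [N (h'^-1 * h)] may differ. The last two conditions
    make the balls a neighbourhood base at the identity. *)
Definition group_norm (R : realType) (G : topologicalGroupType) (N : G -> R) :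
    Prop :=
  [/\ forall g, 0 <= N g,
      forall g h, N (g * h)%g <= N g + N h,
      forall e : R, 0 < e -> nbhs 1%g [set g | N g < e] &
      forall U : set G, nbhs 1%g U ->
        exists2 e : R, 0 < e & [set g | N g < e] `<=` U].

Section BirkhoffKakutani.
Context (R : realType) (G : topologicalGroupType).

Lemma nbhs1_cube (U : set G) : nbhs 1%g U ->
  exists V : set G, nbhs 1%g V /\
    forall a b c, V a -> V b -> V c -> U (a * b * c)%g.
Proof.
have square W : nbhs (1%g : G) W -> exists V : set G, nbhs 1%g V /\
    forall a b, V a -> V b -> W (a * b)%g.
  move=> W1; have := @mulg_continuous G (1%g, 1%g) W.
  rewrite /= mulg1 => /(_ W1) [[A B] [/= nA nB] AB].
  exists (A `&` B); split; first exact: filterI.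
  by move=> a b [Aa _] [_ Bb]; exact: (AB (a, b)).
move=> /square [V [V1 VU]]; have [W [W1 WV]] := square V V1.
exists (V `&` W); split; first exact: filterI.
by move=> a b c [_ Wa] [_ Wb] [Vc _]; apply: VU => //; exact: WV.
Qed.

Let w (n : nat) : R := 2^-1 ^+ n.

Let w_gt0 n : 0 < w n.
Proof. by rewrite exprn_gt0 // invr_gt0. Qed.

Let wS n : w n = 2 * w n.+1.
Proof. by rewrite /w exprS mulrA divff ?mul1r. Qed.

Let w_le n m : (n <= m)%N -> w m <= w n.
Proof.
move=> nm; by apply: ler_wiXn2l => //; rewrite ?invr_ge0 // invf_le1 // ler1n.
Qed.

Let w_lt (e : R) : 0 < e -> exists n, w n < e.
Proof.
move=> /exists_natSinv_lt [n ne]; exists n; apply: le_lt_trans ne.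
rewrite /w exprVn lef_pV2 ?posrE ?exprn_gt0 //.
by rewrite -natrX ler_nat; exact: ltn_expl.
Qed.

(** A letter [(n, g)] stands for an element [g] of the [n]-th neighbourhood and costs [w n]; the
    norm will be the least cost, as an infimum, of a factorization. *)
Let word := seq (nat * G).

Let wprod (s : word) : G := foldr (fun p g => p.2 * g)%g 1%g s.

Let weight (s : word) : R := foldr (fun p r => w p.1 + r) 0 s.

Let wprod_cat s t : wprod (s ++ t) = (wprod s * wprod t)%g.
Proof. by elim: s => [|p s IH] /=; rewrite ?mul1g // IH mulgA. Qed.

Let weight_cat s t : weight (s ++ t) = weight s + weight t.
Proof. by elim: s => [|p s IH] /=; rewrite ?add0r // IH addrA. Qed.

Let weight_ge0 s : 0 <= weight s.
Proof. by elim: s => //= p s IH; rewrite addr_ge0 // ltW. Qed.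

Let weight_split (s : word) (t : R) : 0 <= t -> t < weight s ->
  exists u p v, [/\ s = u ++ p :: v, weight u <= t & t < weight u + w p.1].
Proof.
elim: s t => [|p s IH] t t0 /=; first by rewrite ltNge t0.
have [tp _|pt ts] := ltP t (w p.1).
  by exists [::], p, s; rewrite /= add0r.
have [||u [q [v [-> ut tq]]]] := IH (t - w p.1).
- by rewrite subr_ge0.
- by rewrite ltrBlDl.
- by exists (p :: u), q, v; split => //=; lra.
Qed.

Section Words.
Context (V : nat -> set G).
Hypotheses (V1 : forall n, V n 1%g)
  (V3 : forall n a b c, V n.+1 a -> V n.+1 b -> V n.+1 c -> V n (a * b * c)%g).

Let admissible (s : word) : Prop := foldr (fun p P => V p.1 p.2 /\ P) True s.

Let admissible_cat s t : admissible (s ++ t) <-> admissible s /\ admissible t.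
Proof. by elim: s => [|p s IH] /=; [tauto|rewrite IH; tauto]. Qed.

Let V_le n m : (n <= m)%N -> V m `<=` V n.
Proof.
elim: m => [|m IH]; first by rewrite leqn0 => /eqP ->.
rewrite leq_eqVlt => /predU1P[->//|]; rewrite ltnS => nm g Vg.
by apply: IH => //; rewrite -[g]mulg1 -[g]mulg1; exact: V3.
Qed.

(* Cut the word at the letter where its weight passes one half. *)
Let word_lt (s : word) n : admissible s -> weight s < w n -> V n (wprod s).
Proof.
have [k] := ubnP (size s); elim: k s n => // k IH s n.
case: (posnP (size s)) => [/size0nil -> //|s0] sk /[swap] sn.
have weight_s : 0 < weight s.
  case: (s) s0 => // p s' _ /=.
  by have := w_gt0 p.1; have := weight_ge0 s'; lra.
have [||u [p [v [E ut tp]]]] := @weight_split s (weight s / 2); [lra|lra|].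
move: sk weight_s sn ut tp; rewrite E {E} weight_cat size_cat /= addnS ltnS.
move=> sk weight_s sn ut tp /admissible_cat [Vu [Vp Vv]].
have wn := wS n; have weight_u := weight_ge0 u; have weight_v := weight_ge0 v.
(* The three factors lie in [V n.+1]: [u] and [v] each weigh at most half of the word, less than
   [w n.+1], and the middle letter weighs less than [w n], so its index exceeds [n]. *)
rewrite wprod_cat /= mulgA; apply: V3.
- apply: IH => //; last by lra.
  exact: leq_ltn_trans (leq_addr _ _) sk.
- apply: V_le Vp; rewrite ltnNge; apply/negP => /w_le pn; lra.
- apply: IH => //; last by lra.
  exact: leq_ltn_trans (leq_addl _ _) sk.
Qed.

Hypotheses (Vn : forall n, nbhs 1%g (V n)) (V0 : V 0%N = setT)
  (Vb : forall U : set G, nbhs 1%g U -> exists n, V n `<=` U).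

Let weights (g : G) : set R :=
  [set weight s | s in [set s | admissible s /\ wprod s = g]].

Let weights_inf g : has_inf (weights g).
Proof.
split; last by exists 0 => _ [s _ <-].
(* As [V 0] is the whole group, every element has a one-letter factorization. *)
exists (weight [:: (0%N, g)]), [:: (0%N, g)] => //=.
by rewrite V0 mulg1.
Qed.

Let norm g := inf (weights g).

Let norm_le s : admissible s -> norm (wprod s) <= weight s.
Proof. by move=> Vs; apply: ge_inf; [case: (weights_inf (wprod s))|exists s]. Qed.

Let norm_lt g e : norm g < e ->
  exists s, [/\ admissible s, wprod s = g & weight s < e].
Proof.
move=> ge; have [||_ [s [Vs sg] <-]] := @inf_adherent _ (weights g) (e - norm g).
- by rewrite subr_gt0.
- exact: weights_inf.
- by rewrite addrC subrK => se; exists s.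
Qed.

(** Concatenating words gives subadditivity, one-letter words make the norm small on [V n], and
    [word_lt] bounds the balls from outside. *)
Lemma chain_norm : exists N : G -> R, group_norm N.
Proof.
exists norm; split.
- by move=> g; apply: lb_le_inf; [case: (weights_inf g)|move=> _ [s _ <-]].
- move=> g h; apply/ler_addgt0Pr => e e0.
  have [|s [Vs <- se]] := @norm_lt g (norm g + e / 2).
    by rewrite ltrDl divr_gt0.
  have [|t [Vt <- te]] := @norm_lt h (norm h + e / 2).
    by rewrite ltrDl divr_gt0.
  rewrite -wprod_cat.
  have /norm_le : admissible (s ++ t) by apply/admissible_cat.
  rewrite weight_cat; lra.
- move=> e e0; have [n ne] := w_lt e0; apply: filterS (Vn n) => g Vg.
  apply: le_lt_trans ne; rewrite -[g]mulg1 -[w n]addr0.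
  by apply: (@norm_le [:: (n, g)]).
- move=> U /Vb [n VU]; exists (w n) => // g /norm_lt [s [Vs <- sn]].
  by apply: VU; exact: word_lt.
Qed.

End Words.

Lemma birkhoff_kakutani (B : nat -> set G) : base_seq B ->
  exists N : G -> R, group_norm N.
Proof.
move=> [Bo Bb].
have /choice [cube cubeP] : forall U : set G, exists V : set G, nbhs 1%g U ->
    nbhs 1%g V /\ forall a b c, V a -> V b -> V c -> U (a * b * c)%g.
  move=> U; have [/nbhs1_cube [V VU]|U1] := pselect (nbhs (1%g : G) U).
    by exists V.
  by exists U => /U1.
(* This is [B n] when it contains the identity and the whole group otherwise, hence always a
   neighbourhood of the identity. *)
pose W n := [set g | B n 1%g -> B n g].
have W1 n : nbhs 1%g (W n).
  have [B1|B1] := pselect (B n 1%g); last by apply: filterE => g /B1.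
  apply: filterS (open_nbhs_nbhs (conj (Bo n) B1)) => g Bg _; exact: Bg.
pose V := fix V n := if n is m.+1 then cube (V m) `&` W m else [set: G].
have Vn n : nbhs 1%g (V n).
  elim: n => [|n IH] /=; first exact: filterT.
  by apply: filterI => //; case: (cubeP _ IH).
apply: (@chain_norm V) => //.
- by move=> n; apply: nbhs_singleton.
- by move=> n a b c [Va _] [Vb _] [Vc _]; apply: (cubeP _ (Vn n)).2.
- move=> U; rewrite nbhsE => -[Q [oQ Q1] QU].
  have [n Bn BnQ] := Bb _ _ oQ Q1; exists n.+1 => g [_ Wg].
  exact/QU/BnQ/Wg.
Qed.

End BirkhoffKakutani.

(** * The space of sequences of Lipschitz functions *)

Section Norm.
Context (R : realType) (G : topologicalGroupType) (N : G -> R).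
Hypothesis hN : group_norm N.

Lemma group_norm1 : N 1%g = 0.
Proof.
case: hN => N0 _ Nn _; apply/eqP; rewrite eq_le N0 andbT.
by apply/ler_addgt0Pr => e /Nn /nbhs_singleton /ltW; rewrite add0r.
Qed.

Lemma nbhs_group_norm (S : topologicalType) (a : S -> G) (s : S) (e : R) :
  continuous a -> a s = 1%g -> 0 < e -> nbhs s [set t | N (a t) < e].
Proof.
case: hN => _ _ Nn _ ac as1 e0.
by apply: (ac s [set g | N g < e]); rewrite as1; exact: Nn.
Qed.

Lemma open_group_norm (h : G) (e : R) : open [set g | N (g * h)%g < e].
Proof.
case: hN => _ ND _ _; rewrite openE => g /= ge.
have : nbhs g [set t | N ((g * h)^-1 * (t * h))%g < e - N (g * h)%g].
  apply: nbhs_group_norm; last by rewrite subr_gt0.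
    apply: continuous_mulg; first by move=> t; exact: cvg_cst.
    by apply: continuous_mulg => t; [exact: cvg_id|exact: cvg_cst].
  by rewrite mulVg.
apply: filterS => t /=; rewrite ltrBrDl; apply: le_lt_trans.
by apply: le_trans (ND _ _); rewrite mulVKg.
Qed.

End Norm.

Definition lip_fun (R : realType) (G : groupType) (N : G -> R)
    (F : nat -> G -> R) : Prop :=
  forall n, (forall h, 0 <= F n h <= 1) /\
    forall h h', F n h' <= F n h + N (h^-1 * h')%g.

Definition lip_family (R : realType) (G : groupType) (N : G -> R) : Type :=
  {F : nat -> G -> R | lip_fun N F}.

Section LipFamily.
Context (R : realType) (G : groupType) (N : G -> R).
Implicit Types F : lip_family N.

Lemma lip_family_eq F F' : sval F = sval F' -> F = F'.
Proof.
case: F F' => F hF [F' hF'] /= E; rewrite {F}E in hF *.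
by congr exist; exact: Prop_irrelevance.
Qed.

Lemma lip_fun_translate g F : lip_fun N (fun n h => sval F n (g^-1 * h)%g).
Proof.
move=> n; case: F => F /= /(_ n) [F01 FN]; split=> // h h'.
by have := FN (g^-1 * h)%g (g^-1 * h')%g; rewrite invgM invgK -mulgA mulVKg.
Qed.

Definition lip_act g F : lip_family N := exist _ _ (lip_fun_translate g F).

Lemma lip_act_action : group_action lip_act.
Proof.
split=> [F|g k F]; apply: lip_family_eq; apply/funext => n; apply/funext => h /=.
  by rewrite invg1 mul1g.
by rewrite invgM mulgA.
Qed.

(** One index codes a function and a point of [q]. Indices that code no pair give 0, which stays in
    the unit interval and separates nothing. *)
Definition lip_coord (q : nat -> G) F (k : nat) : R :=
  if unpickle k is Some (n, m) then sval F n (q m) else 0.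

Lemma lip_coordE q F n m : lip_coord q F (pickle (n, m)) = sval F n (q m).
Proof. by rewrite /lip_coord pickleK. Qed.

Lemma lip_coord01 q F k : 0 <= lip_coord q F k <= 1.
Proof.
rewrite /lip_coord; case: unpickle => [[n m]|]; last by rewrite lexx ler01.
by case: F => F /= /(_ n) [].
Qed.

End LipFamily.

Section LipSpace.
Context (R : realType) (G : topologicalGroupType) (N : G -> R) (q : nat -> G).
Hypotheses (hN : group_norm N)
  (qd : forall U : set G, open U -> U !=set0 -> exists n, U (q n)).
Implicit Types F : lip_family N.

(** The Lipschitz inequality is used in both directions, on two neighbourhoods since [N] may be
    asymmetric. The bound is uniform in [F] and [n], which lets values on the dense sequence control
    all others. *)
Lemma lip_equicontinuous (h : G) (e : R) : 0 < e ->
  nbhs h [set h' | forall F n, `|sval F n h' - sval F n h| < e].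
Proof.
move=> e0.
have h1 : nbhs h [set h' | N (h^-1 * h')%g < e].
  apply: (nbhs_group_norm hN) => //; last by rewrite mulVg.
  by apply: continuous_mulg => t; [exact: cvg_cst|exact: cvg_id].
have h2 : nbhs h [set h' | N (h'^-1 * h)%g < e].
  apply: (nbhs_group_norm hN) => //; last by rewrite mulVg.
  apply: continuous_mulg => t; last exact: cvg_cst.
  by apply: (@continuous_invg G G id) => ?; exact: cvg_id.
apply: filterS (filterI h1 h2) => h' /= [a b] [F /= hF] n.
have [_ FN] := hF n; have := FN h h'; have := FN h' h.
by rewrite ltr_distl; move=> ? ?; apply/andP; split; lra.
Qed.

Lemma lip_dense_approx (h : G) (e : R) : 0 < e ->
  exists m, forall F n, `|sval F n (q m) - sval F n h| < e.
Proof.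
move=> /(lip_equicontinuous h); rewrite nbhsE /= => -[W [oW Wh] We].
by have [|m Wm] := qd oW; [exists h|exists m; exact: We].
Qed.

Lemma lip_coord_inj F F' :
  (forall k, lip_coord q F k = lip_coord q F' k) -> F = F'.
Proof.
move=> FF'; apply: lip_family_eq; apply/funext => n; apply/funext => h.
apply/eqP; rewrite -subr_eq0 -normr_le0; apply/ler_addgt0Pr => e e0.
have [|m mP] := @lip_dense_approx h (e / 2); first by rewrite divr_gt0.
have := FF' (pickle (n, m)); rewrite !lip_coordE => E.
have := mP F n; have := mP F' n; rewrite E add0r (distrC _ (sval F n h)).
have := ler_normD (sval F n h - sval F' n (q m))
  (sval F' n (q m) - sval F' n h).
by rewrite addrA subrK => ? ? ?; lra.
Qed.

(** Convergence along [q] spreads to every point by uniform approximation, and the defining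
    inequalities survive pointwise limits. The quarters of [e] pay for two approximations and two
    distances to the limit. *)
Lemma lip_coord_complete (u : nat -> lip_family N) :
  (forall k, exists l : R, (fun i => lip_coord q (u i) k) @ \oo --> l) ->
  exists F, forall k, (fun i => lip_coord q (u i) k) @ \oo --> lip_coord q F k.
Proof.
move=> uc.
have /choice [L LP] : forall p : nat * G, exists l : R,
    (fun i => sval (u i) p.1 p.2) @ \oo --> l.
  move=> [n h] /=; apply: real_cauchy_cvg => e e0.
  have [|m mP] := @lip_dense_approx h (e / 4); first by rewrite divr_gt0.
  have [l] := uc (pickle (n, m)).
  rewrite (_ : (fun i => _) = (fun i => sval (u i) n (q m))); last first.
    by apply/funext => i; rewrite lip_coordE.
  move=> /real_cvg_seqP /(_ (e / 4)) [|M MP]; first by rewrite divr_gt0.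
  exists M => i j /MP + /MP; have := mP (u i) n; have := mP (u j) n.
  by rewrite !ltr_distl => /andP[? ?] /andP[? ?] /andP[? ?] /andP[? ?];
    apply/andP; split; lra.
have LN : lip_fun N (fun n h => L (n, h)).
  move=> n; split=> [h|h h'].
    apply/andP; split.
      apply: (@ler_cvg_to _ _ _ _ (fun=> 0) _ _ _ (@cvg_cst _ _ _ _ _) (LP (n, h))).
      by apply: nearW => i; case: (svalP (u i) n) => /(_ h) /andP[].
    apply: (@ler_cvg_to _ _ _ _ _ (fun=> 1) _ _ (LP (n, h)) (@cvg_cst _ _ _ _ _)).
    by apply: nearW => i; case: (svalP (u i) n) => /(_ h) /andP[].
  apply: (ler_cvg_to (LP (n, h')) (cvgD (LP (n, h)) (@cvg_cst _ _ _ _ _))).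
  by apply: nearW => i; case: (svalP (u i) n) => _; exact.
exists (exist _ _ LN) => k; rewrite /lip_coord.
by case: unpickle => [[n m]|]; [exact: LP (n, q m)|exact: cvg_cst].
Qed.

(** Moving [g] costs little, uniformly in the function, by equicontinuity; moving [x] is then tested
    at one [q j] close to [g^-1 * q m]. The map [ev] carries the topology, as [lip_family] has none
    of its own. *)
Lemma lip_act_continuous (U : topologicalType) (ev : U -> lip_family N) :
  (forall k, continuous (fun x => lip_coord q (ev x) k)) ->
  forall k, continuous (fun p : G * U => lip_coord q (lip_act p.1 (ev p.2)) k).
Proof.
move=> evc k; rewrite /lip_coord.
case: unpickle => [[n m]|]; last by move=> ?; exact: cvg_cst.
move=> [g x]; apply/cvgrPdist_lt => e e0 /=.
have e4 : 0 < e / 4 by rewrite divr_gt0.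
have [j jP] := lip_dense_approx (g^-1 * q m)%g e4.
have gP : nbhs g [set k : G | forall F n, `|sval F n (k^-1 * q m)%g -
    sval F n (g^-1 * q m)%g| < e / 4].
  have c : continuous (fun k : G => (k^-1 * q m)%g).
    apply: continuous_mulg => t; last exact: cvg_cst.
    by apply: (@continuous_invg G G id) => ?; exact: cvg_id.
  exact: (c g _ (lip_equicontinuous _ e4)).
have xP : nbhs x [set y | `|sval (ev x) n (q j) - sval (ev y) n (q j)| < e / 4].
  move/cvgrPdist_lt: (evc (pickle (n, j)) x) => /(_ _ e4).
  by apply: filterS => y; rewrite !lip_coordE.
exists ([set k : G | forall F n, `|sval F n (k^-1 * q m)%g -
    sval F n (g^-1 * q m)%g| < e / 4],
  [set y | `|sval (ev x) n (q j) - sval (ev y) n (q j)| < e / 4]) => //.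
move=> [k' y] /= [kP yP]; have := kP (ev y) n; have := jP (ev y) n.
have := jP (ev x) n; move: yP; rewrite !ltr_distl.
by move=> /andP[? ?] /andP[? ?] /andP[? ?] /andP[? ?]; apply/andP; split; lra.
Qed.

Definition lip_space : topologicalType :=
  metrized (coord_dist (@lip_coord R G N q)).

Let lip_space_induces :
  induces_topology (T := lip_space) (coord_dist (@lip_coord R G N q)).
Proof. exact: metrized_induces. Qed.

Lemma lip_polish_Gspace :
  polish_Gspace R (X := lip_space) (@lip_act R G N).
Proof.
(* The zero family supplies the point that [coord_polish] asks for. *)
have F0 : lip_fun N (fun _ _ => 0).
  move=> n; split=> [h|h h']; first by rewrite lexx ler01.
  by rewrite add0r; case: hN.
split; [|exact: lip_act_action|].
  apply: (@coord_polish R lip_space _ lip_space_induces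
    (@lip_coord01 R G N q) lip_coord_inj (exist _ _ F0)).
  exact: lip_coord_complete.
apply: (@continuous_coords R lip_space _ lip_space_induces
  (@lip_coord01 R G N q)).
apply: (@lip_act_continuous lip_space id) => k.
exact: (@continuous_coord R lip_space _ lip_space_induces
  (@lip_coord01 R G N q) lip_coord_inj).
Qed.

Lemma borel_map_lip (X : topologicalType) (f : X -> lip_family N) :
  (forall n h (r : R), borel_set [set x | sval (f x) n h < r]) ->
  borel_map (T := lip_space) f.
Proof.
move=> fb; apply: (@borel_map_coords R lip_space _ lip_space_induces
  (@lip_coord01 R G N q) lip_coord_inj) => k r.
rewrite /lip_coord; case: unpickle => [[n m]|]; first exact: fb.
exact: borel_cst.
Qed.

End LipSpace.

(** * The embedding *)

Lemma meager_mulr (G : topologicalGroupType) (k : G) (A : set G) :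
  meager A -> meager [set g | A (g * k)%g].
Proof.
have c (l : G) : continuous (fun g : G => (g * l)%g).
  by apply: continuous_mulg => t; [exact: cvg_id|exact: cvg_cst].
by apply: (meager_homeo (c k) (c k^-1%g)) => g; rewrite ?mulgK ?mulgVK.
Qed.

Section Embedding.
Context (R : realType) (G : topologicalGroupType) (N : G -> R).
Context (X : topologicalType) (a : G -> X -> X).
Context (B : nat -> set G) (A : nat -> set X).
Hypotheses (hN : group_norm N) (bG : base_seq B) (baireG : baire_space G).
Hypotheses (ha : group_action a) (aB : borel_map (fun p : G * X => a p.1 p.2)).
Hypothesis Ao : forall n, open (A n).

Definition visits n x : set G := [set g | A n (a g x)].

(** As [g * h] is [(g^-1)^-1 * h], this bounds the left-invariant distance from [g^-1] to [h]. *)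
Definition near_inv (h : G) (r : R) : set G := [set g | N (g * h)%g < r].

(** The member 1 truncates the infimum and keeps the set nonempty. *)
Definition nonmeager_radii n x h : set R :=
  [set r | r = 1 \/ ~ meager (visits n x `&` near_inv h r)].

(* The distance, truncated at 1, from [h] to the set of inverses of the points
   near which [visits n x] is nonmeager. *)
Definition category_dist (x : X) n h : R := inf (nonmeager_radii n x h).

Lemma nonmeager_radii_inf n x h : has_inf (nonmeager_radii n x h) /\
  lbound (nonmeager_radii n x h) 0.
Proof.
have lb : lbound (nonmeager_radii n x h) 0.
  move=> r [->//|nm]; rewrite leNgt; apply/negP => r0; apply: nm.
  apply: sub_meager (@meager0 G) => g [_ /= gr].
  by case: hN => /(_ (g * h)%g); rewrite leNgt (lt_trans gr).
by split => //; split; [exists 1; left|exists 0].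
Qed.

Lemma category_dist_lt x n h r : category_dist x n h < r <->
  exists2 t, nonmeager_radii n x h t & t < r.
Proof.
have [rinf rlb] := nonmeager_radii_inf n x h; split=> [dr|[t tE]].
  have [|t tE] := @inf_adherent _ _ (r - category_dist x n h) _ rinf.
    by rewrite subr_gt0.
  by rewrite addrC subrK; exists t.
by apply: le_lt_trans; apply: ge_inf => //; exists 0.
Qed.

Lemma nonmeager_radii_le n x h r s : r <= s ->
  ~ meager (visits n x `&` near_inv h r) ->
  ~ meager (visits n x `&` near_inv h s).
Proof.
move=> rs; apply: contra_not; apply: sub_meager => g [gx gr]; split => //.
exact: lt_le_trans rs.
Qed.

(** By subadditivity [near_inv h t] lies in [near_inv h' (t + N (h^-1 * h'))], so a radius that
    works at [h] works at [h'] after this enlargement. *)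
Lemma category_dist_lip x : lip_fun N (category_dist x).
Proof.
move=> n; split=> [h|h h'].
  have [rinf rlb] := nonmeager_radii_inf n x h; apply/andP; split.
    by apply: lb_le_inf => //; case: rinf.
  by apply: ge_inf; [case: rinf|left].
case: (hN) => N0 ND _ _; apply/ler_addgt0Pr => e e0.
have [|t tE te] := (category_dist_lt x n h (category_dist x n h + e)).1.
  by rewrite ltrDl.
have hh' := N0 (h^-1 * h')%g.
suff : category_dist x n h' <= t + N (h^-1 * h')%g by lra.
have [rinf _] := nonmeager_radii_inf n x h'.
case: tE => [t1|tE].
  have : category_dist x n h' <= 1 by apply: ge_inf; [case: rinf|left].
  lra.
apply: ge_inf; [by case: rinf|right].
apply: contra_not tE; apply: sub_meager => g [gx gt]; split => //.
rewrite /near_inv /=; apply: le_lt_trans (_ : _ <= N (g * h)%g + N (h^-1 * h')%g) _.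
  by have := ND (g * h)%g (h^-1 * h')%g; rewrite mulgA mulgK.
by rewrite ltrD2r.
Qed.

(** Replacing [g] by [g * k] carries the sets defined by [a k x] and [h] to those defined by [x] and
    [k^-1 * h], and preserves meagerness. *)
Lemma category_dist_equivariant k x n h :
  category_dist (a k x) n h = category_dist x n (k^-1 * h)%g.
Proof.
case: ha => _ aM; congr inf; apply/seteqP; split=> r [->|nm]; try by left.
- right; apply: contra_not nm => /(meager_mulr k); apply: sub_meager.
  move=> g [gx gr]; split; first by move: gx; rewrite /visits /= aM.
  by rewrite /near_inv /= -mulgA mulVKg.
- right; apply: contra_not nm => /(meager_mulr k^-1%g); apply: sub_meager.
  move=> g [gx gr]; split; first by rewrite /visits /= -aM mulgVK.
  by move: gr; rewrite /near_inv /= -mulgA.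
Qed.

Lemma category_dist_borel n h r :
  borel_set [set x | category_dist x n h < r].
Proof.
(* Nonmeagerness is monotone in the radius, so rational radii suffice; the first set accounts for
   the truncation value. *)
rewrite (_ : mkset _ = [set _ | 1 < r] `|` \bigcup_(s : rat)
   ([set _ | ratr s < r] `&`
    [set x | ~ meager (visits n x `&` near_inv h (ratr s))])).
  apply: borel_setU; first exact: borel_cst.
  apply: borel_bigcup => s; have [sr|sr] := pselect (ratr s < r).
    rewrite (_ : [set _ | _] = setT) ?setTI; last by rewrite predeqE.
    apply: (borel_nonmeager_section (A := [set p | A n (a p.1 p.2)]) bG) => //.
      by apply: aB; exact: borel_open.
    exact: open_group_norm.
  rewrite (_ : [set _ | _] = set0) ?set0I; first exact: sigma_algebra0.
  by rewrite predeqE.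
apply/seteqP; split => x /=.
  move=> /category_dist_lt [t [->|nm] tr]; [by left|right].
  have /rat_in_itvoo [s] := tr; rewrite in_itv /= => /andP[ts sr].
  by exists s => //; split => //; exact: nonmeager_radii_le (ltW ts) nm.
move=> [r1|[s _ [/= sr nm]]]; apply/category_dist_lt.
  by exists 1 => //; left.
by exists (ratr s) => //; right.
Qed.

(** A nonmeager difference is comeager in some basic set [B i]. At the inverse of a point [v] of
    [B i] the value for [x] is then small, while [visits n y] is meager near [v], which keeps the
    value for [y] away from 0. *)
Lemma category_dist_meager n x y :
  (forall h, category_dist x n h = category_dist y n h) ->
  meager (visits n x `\` visits n y).
Proof.
move=> xy; apply: contrapT => nm.
have bv z : borel_set (visits n z).
  apply: (@continuous_borel_map _ _ (fun g : G => (g, z)) _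
    [set p | A n (a p.1 p.2)]); last by apply: aB; exact: borel_open.
  by move=> g; apply: cvg_pair; [exact: cvg_id|exact: cvg_cst].
have bp : baire_property (visits n x `\` visits n y).
  by apply: (borel_baire_property bG); exact: borel_setD.
have [|i [[v Bv] _ mB]] := baire_property_nonmeager bG bp openT.
  by rewrite setIT.
have oB := bG.1 i.
have [e e0 eB] : exists2 e : R, 0 < e & near_inv v^-1%g e `<=` B i.
  case: (hN) => _ _ _ Nb.
  have [|e e0 eB] := Nb [set g | B i (g * v)%g].
    have c : continuous (fun g : G => (g * v)%g).
      by apply: continuous_mulg => t; [exact: cvg_id|exact: cvg_cst].
    apply: (c 1%g); rewrite mul1g; exact: open_nbhs_nbhs.
  by exists e => // g /eB /=; rewrite mulgVK.
(* The minimum with 1 excludes the truncation value when the bound is transferred to [y]. *)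
have : category_dist x n v^-1%g < Num.min e 1.
  pose r := Num.min e 1 / 2.
  have r0 : 0 < Num.min e 1 by rewrite lt_min e0 ltr01.
  apply/category_dist_lt; exists r; last by rewrite /r; lra.
  right; rewrite -[near_inv _ _]setIid setIA.
  have rB : near_inv v^-1%g r `<=` B i.
    move=> g /= gr; apply: eB => /=; apply: lt_le_trans gr _.
    have : Num.min e 1 <= e by rewrite ge_min lexx.
    rewrite /r; lra.
  move=> mr; apply: (@nonmeager_open _ (visits n x) (B i) (near_inv v^-1%g r)) => //.
  - by apply: sub_meager mB => g [Bg nx]; split => // -[].
  - exact: open_group_norm.
  - exists v; rewrite /near_inv /= mulgV (group_norm1 hN) /r; lra.
  - by apply: sub_meager mr => g [? ?].
rewrite xy => /category_dist_lt [t]; rewrite lt_min => -[->|nmt] /andP[te t1].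
  by rewrite ltxx in t1.
apply: nmt; apply: sub_meager mB => g [gy gt]; split.
  by apply: eB; exact: lt_trans te.
by move=> [_]; exact.
Qed.

Hypothesis A_sep : forall x y, (forall n, A n x -> A n y) -> x = y.

Lemma category_dist_inj x y : category_dist x = category_dist y -> x = y.
Proof.
move=> xy; case: ha => a1 aM.
have m : meager (\bigcup_n ((visits n x `\` visits n y))).
  by apply: meager_bigcup => n; apply: category_dist_meager => h; rewrite xy.
have [|g _ ng] := meager_open_notin baireG m openT; first by exists 1%g.
suff E : a g x = a g y by rewrite -[x]a1 -[y]a1 -(mulVg g) !aM E.
apply: A_sep => n gx; apply: contrapT => gy; apply: ng.
by exists n.
Qed.

End Embedding.

(** One implication is enough: for distinct points, the ball about [x] of radius [d x y] contains a
    basic set around [x] that misses [y]. *)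
Lemma base_seq_separates (R : realType) (X : topologicalType)
    (A : nat -> set X) (x y : X) : polish R X -> base_seq A ->
  (forall n, A n x -> A n y) -> x = y.
Proof.
move=> [_ [d [dm dt _]]] [_ Ab] xy; case: (dm) => d0 dE _ _.
apply/dE/eqP; rewrite eq_le d0 andbT leNgt; apply/negP => dxy.
have [|n Ax /(_ y (xy n Ax)) /=] :=
  Ab _ x (open_metric_ball dm dt x (d x y)).
  by rewrite /= (metricxx dm).
by rewrite ltxx.
Qed.

Theorem theorem2p1 (R : realType) (G : topologicalGroupType) (hG : polish R G) :
  (exists (U : topologicalType) (b : G -> U -> U),
      universal_borel_Gspace R b) /\
  (exists (U : topologicalType) (b : G -> U -> U),
      polish_Gspace R b /\ universal_borel_Gspace R b).
Proof.
suff H : exists (U : topologicalType) (b : G -> U -> U),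
    polish_Gspace R b /\ universal_borel_Gspace R b.
  by split => //; have [U [b [_ ?]]] := H; exists U, b.
have [B bG] := polish_base_seq hG.
have [N hN] := birkhoff_kakutani R bG.
have [q qd] := base_seq_dense_seq 1%g bG.
have PG := lip_polish_Gspace hN qd.
exists (lip_space N q), (@lip_act R G N); split => //; split.
  by case: PG => pU act ac; split => //; exact: continuous_borel_map.
move=> X a [pX ha aB]; have [A bA] := polish_base_seq pX.
have baireG : baire_space G by move=> D; exact: polish_baire hG.
exists (fun x => exist _ _ (@category_dist_lip R G N X a A hN x)); split.
- apply: (borel_map_lip hN qd) => n h r /=.
  by apply: (category_dist_borel hN bG baireG aB); exact: bA.1.
- move=> x y /(congr1 sval) /=.
  apply: (category_dist_inj hN bG baireG ha aB bA.1) => u v.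
  exact: base_seq_separates pX bA.
- move=> g x; apply: lip_family_eq; apply/funext => n; apply/funext => h /=.
  exact: category_dist_equivariant.
Qed.
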